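(* The following two statements are equivalent: (1) for every stream $s$, $\mu\mathcal{W}\,s$ implies that there exists $n\in\mathbb{N}$ with $\mathit{le}_n\,s$; (2) for every stream $s$, $\mathcal{F}\,\mathit{red}\,s\ \vee\ \mathcal{G}\,\mathit{blue}\,s$ (this is LPO).
   Context: The equivalence is to be proved constructively (intuitionistic type theory with inductive and coinductive definitions; no excluded middle, no Markov's principle). A color is one of $R$ (red), $B$ (blue). A stream is an element of the coinductive type whose only constructor forms $c\,s$ from a color $c$ and a stream $s$; streams are considered up to bisimilarity (equivalently, functions $\mathbb{N}\to\{R,B\}$ up to pointwise equality). $\mathit{red}\,s$ means $s=R\,s'$ for some $s'$; $\mathit{blue}\,s$ means $s=B\,s'$ for some $s'$. For a stream predicate $X$: $\mathcal{F}\,X$ is defined inductively by the rules: $X\,s$ implies $\mathcal{F}\,X\,s$; $\mathcal{F}\,X\,s$ implies $\mathcal{F}\,X\,(c\,s)$ for any color $c$. $\mathcal{G}\,X$ is defined coinductively by the rule: $X\,(c\,s)$ and $\mathcal{G}\,X\,s$ imply $\mathcal{G}\,X\,(c\,s)$. The relation $\mathit{le}_n\,s$ (''$s$ has fewer than $n$ red positions'') is defined coinductively by the rules: $\mathit{le}_{n+1}\,s$ implies $\mathit{le}_{n+1}\,(B\,s)$; $\mathit{le}_n\,s$ implies $\mathit{le}_{n+1}\,(R\,s)$. There is no rule for $\mathit{le}_0$, so $\mathit{le}_0\,s$ is always false. For a stream predicate $X$, the weak until predicate $\mathcal{W}_X$ is defined coinductively by the rules: $\mathcal{W}_X\,s$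 implies $\mathcal{W}_X\,(B\,s)$; $X\,s$ implies $\mathcal{W}_X\,(R\,s)$. The operator $X\mapsto\mathcal{W}_X$ is monotone, and $\mu\mathcal{W}$ (''almost always blue'') is its least fixed point, i.e. the predicate defined inductively by the rule: $\mathcal{W}_{\mu\mathcal{W}}\,s$ implies $\mu\mathcal{W}\,s$ (equivalently, Mendler-style: if $X$ is a stream predicate with $\forall s'.\,X\,s'\Rightarrow\mu\mathcal{W}\,s'$ and $\mathcal{W}_X\,s$, then $\mu\mathcal{W}\,s$). *)

(* Defs.v *)
From Stdlib Require Export Streams.

Inductive color : Set := Red | Blue.

(* Streams are compared by [EqSt] (bisimilarity). All the predicates below are
   invariant under it ([F], [G] and [W] when their argument is), so quantifying
   over [stream] amounts to quantifying over streams up to bisimilarity. *)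
Notation stream := (Stream color).

Definition red (s : stream) : Prop := exists s', s = Cons Red s'.
Definition blue (s : stream) : Prop := exists s', s = Cons Blue s'.

Inductive F (X : stream -> Prop) : stream -> Prop :=
| F_here s : X s -> F X s
| F_later c s : F X s -> F X (Cons c s).

CoInductive G (X : stream -> Prop) : stream -> Prop :=
| G_cons c s : X (Cons c s) -> G X s -> G X (Cons c s).

(* Despite the name, [le n s] says that [s] has strictly fewer than [n] red
   positions; hence no constructor at [0]. *)
CoInductive le : nat -> stream -> Prop :=
| le_blue n s : le (S n) s -> le (S n) (Cons Blue s)
| le_red n s : le n s -> le (S n) (Cons Red s).

CoInductive W (X : stream -> Prop) : stream -> Prop :=
| W_blue s : W X s -> W X (Cons Blue s)
| W_red s : X s -> W X (Cons Red s).

(* Least fixed point of [W] in Mendler style: Rocq accepts the direct rule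
   [W muW s -> muW s], but its guard condition then rejects recursion through
   the nested coinductive [W], so no induction principle would be derivable.
   [muW_fold] and [muW_least] show that this is the least fixed point. *)
Inductive muW (s : stream) : Prop :=
| muW_intro (X : stream -> Prop) :
    (forall s', X s' -> muW s') -> W X s -> muW s.

Lemma muW_fold (s : stream) : W muW s -> muW s.
Proof. exact (muW_intro s muW (fun _ m => m)). Qed.

Lemma W_monotone (X Y : stream -> Prop) :
  (forall s, X s -> Y s) -> forall s, W X s -> W Y s.
Proof. intros XY; cofix IH; intros s [t w | t x]; constructor; auto. Qed.

Lemma muW_least (P : stream -> Prop) :
  (forall s, W P s -> P s) -> forall s, muW s -> P s.
Proof.
intros HP; fix IH 2; intros s [X XmuW w].
apply HP, (W_monotone X); auto.
Qed.

(* Main.v *)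
(** From LPO to (1): by induction on [muW], decide whether the stream has a red
    position; if so, use the bound of the tail after the first one, otherwise
    the bound is [1].

    From (1) to LPO: send [s] to the stream that stays blue as long as [s] does
    and, if the first red of [s] is at position [k], then has exactly [k + 1]
    reds. It is almost always blue whatever [s] is, and a bound [n] on its reds
    says that the first red of [s], if any, lies below [n], so that it suffices
    to inspect a finite prefix of [s]. *)
Require Import Defs.
From Stdlib Require Import Lia.

Lemma le_inv (n : nat) (s : stream) :
  le n s ->
  match n, s with
  | 0, _ => False
  | S m, Cons Blue s' => le (S m) s'
  | S m, Cons Red s' => le m s'
  end.
Proof. intros [m s' H | m s' H]; exact H. Qed.

Lemma W_inv (X : stream -> Prop) (s : stream) :
  W X s -> match s with Cons Blue s' => W X s' | Cons Red s' => X s' end.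
Proof. intros [s' H | s' H]; exact H. Qed.

Lemma G_blue_le (s : stream) : G blue s -> le 1 s.
Proof.
revert s; cofix IH; intros s [c s' b g].
destruct c.
- exfalso; destruct b as [t e]; discriminate e.
- constructor; apply IH, g.
Qed.

(** Leading blues keep the bound, so the induction stops at the first red, where [W] bounds the
    tail. *)
Lemma F_red_le (s : stream) :
  F red s -> W (fun t => exists n, le n t) s -> exists n, le n s.
Proof.
assert (le_Red : forall t, (exists n, le n t) -> exists n, le n (Cons Red t)).
{ intros t [n H]; exists (S n); constructor; exact H. }
induction 1 as [s [s' ->] | [|] s _ IH]; intros w; apply W_inv in w.
- apply le_Red, w.
- apply le_Red, w.
- destruct (IH w) as [[|n] H].
  + destruct (le_inv _ _ H).
  + exists (S n); constructor; exact H.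
Qed.

Lemma LPO_muW_le :
  (forall s : stream, F red s \/ G blue s) ->
  forall s : stream, muW s -> exists n : nat, le n s.
Proof.
intros lpo; apply muW_least; intros s w.
destruct (lpo s) as [f | g].
- exact (F_red_le s f w).
- exists 1; exact (G_blue_le s g).
Qed.

CoFixpoint blues : stream := Cons Blue blues.

Fixpoint reds (k : nat) : stream :=
  match k with
  | 0 => blues
  | S k => Cons Red (reds k)
  end.

(** [k] counts the blues already passed. *)
CoFixpoint spread (k : nat) (s : stream) : stream :=
  match s with
  | Cons Blue s => Cons Blue (spread (S k) s)
  | Cons Red _ => Cons Red (reds k)
  end.

Lemma W_blues (X : stream -> Prop) : W X blues.
Proof.
cofix IH.
(* A bare match on the unfolding equation keeps the corecursive call guarded. *)
case (eq_sym (unfold_Stream blues)); simpl.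
constructor; exact IH.
Qed.

Lemma muW_reds (k : nat) : muW (reds k).
Proof.
induction k as [|k IH]; apply muW_fold; simpl.
- apply W_blues.
- constructor; exact IH.
Qed.

(** One unfolding of [muW] suffices: the coinductive [W] absorbs the possibly infinite blue
    prefix. *)
Lemma muW_spread (k : nat) (s : stream) : muW (spread k s).
Proof.
apply muW_fold; revert k s; cofix IH; intros k s.
case (eq_sym (unfold_Stream (spread k s))).
destruct s as [[|] s]; simpl; constructor.
- apply muW_reds.
- apply IH.
Qed.

Lemma le_reds (n k : nat) : le n (reds k) -> k < n.
Proof.
revert n; induction k as [|k IH]; intros [|n] H; apply le_inv in H.
- destruct H.
- lia.
- destruct H.
- apply IH in H; lia.
Qed.

Lemma le_spread_Blue (n k : nat) (s : stream) :
  le n (spread k (Cons Blue s)) -> le n (spread (S k) s).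
Proof. intros H; apply le_inv in H; destruct n; [destruct H | exact H]. Qed.

Lemma le_spread_Red (n k : nat) (s : stream) :
  le n (spread k (Cons Red s)) -> S k < n.
Proof.
intros H; apply le_inv in H; destruct n; [destruct H |].
apply le_reds in H; lia.
Qed.

(** A red head would force [S k < n], and [k] only grows along the blues. *)
Lemma le_spread_G_blue (n k : nat) (s : stream) :
  le n (spread k s) -> n <= S k -> G blue s.
Proof.
revert k s; cofix IH; intros k [[|] s] H nk.
- exfalso; apply le_spread_Red in H; lia.
- constructor.
  + exists s; reflexivity.
  + apply (IH (S k)); [apply le_spread_Blue, H | lia].
Qed.

(** [m] is fuel: each blue read raises [k], until [n <= S k] excludes any further red. *)
Lemma le_spread_decide (n m k : nat) (s : stream) :
  le n (spread k s) -> n <= m + S k -> F red s \/ G blue s.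
Proof.
revert k s; induction m as [|m IH]; intros k s H nk.
- right; exact (le_spread_G_blue n k s H nk).
- destruct s as [[|] s].
  + left; apply F_here; exists s; reflexivity.
  + destruct (IH (S k) s) as [f | g].
    * apply le_spread_Blue, H.
    * lia.
    * left; apply F_later, f.
    * right; constructor; [exists s; reflexivity | exact g].
Qed.

Theorem lemma4p8 :
  (forall s : stream, muW s -> exists n : nat, le n s) <->
  (forall s : stream, F red s \/ G blue s).
Proof.
split.
- intros bound s.
  destruct (bound (spread 0 s) (muW_spread 0 s)) as [n H].
  apply (le_spread_decide n n 0 s H); lia.
- exact LPO_muW_le.
Qed.
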